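(* Let $L\in(0,\infty)$, $\mu\in(-\infty,0]$, let $f\in\mathcal{F}_{\mu,L}(\mathbb{R}^n)$ with $f^\star:=\inf_{x\in\mathbb{R}^n} f(x)$ finite, let $x^1\in\mathbb{R}^n$, and let $f$ satisfy the Polyak-Łojasiewicz inequality with constant $\mu_p\in(0,L]$ on $X=\{x: f(x)\le f(x^1)\}$. Put $\tau=\tfrac{3}{\mu+L+\sqrt{\mu^2-L\mu+L^2}}$ and $$r(t)=L\mu(L+\mu-\mu_p)t^3-\left(L^2-\mu_p(L+\mu)+5L\mu+\mu^2\right)t^2+4(L+\mu)t-4,$$ and let $\bar t$ be the unique root of $r$ in $\left[\tfrac1L,\tau\right]$ if it exists. Let $t^\star=\bar t$ if $\bar t$ exists and $t^\star=\tau$ otherwise. Then $t^\star$ is the optimal step length for the gradient method $x^2=x^1-t\nabla f(x^1)$ with respect to the worst-case convergence rate $h$, i.e. $t^\star$ minimizes the function $h$ (defined in the context) over $t\in(0,\tfrac2L)$.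
   Context: $\|\cdot\|$ is the Euclidean norm. $\mathcal{F}_{\mu,L}(\mathbb{R}^n)$ denotes the set of differentiable functions $f:\mathbb{R}^n\to\mathbb{R}$ such that both $\tfrac{L}{2}\|\cdot\|^2-f$ and $f-\tfrac{\mu}{2}\|\cdot\|^2$ are convex. $f$ satisfies the Polyak-Łojasiewicz (PŁ) inequality with constant $\mu_p>0$ on $X$ if $f(x)-f^\star\le\tfrac{1}{2\mu_p}\|\nabla f(x)\|^2$ for all $x\in X$. The worst-case convergence rate referred to is the upper bound $h(t)$ on $\frac{f(x^2)-f^\star}{f(x^1)-f^\star}$ for one gradient step $x^2=x^1-t\nabla f(x^1)$, given on $(0,\tfrac2L)$, with $\tau=\tfrac{3}{\mu+L+\sqrt{\mu^2-L\mu+L^2}}$, by $$h(t)=\begin{cases}\left(\dfrac{\mu_p(1-Lt)+\sqrt{(L-\mu)(\mu-\mu_p)(2-Lt)\mu_p t+(L-\mu)^2}}{L-\mu+\mu_p}\right)^2 & t\in(0,\tfrac1L),\\[2mm] \dfrac{(Lt-2)(\mu t-2)\mu_p t}{(L+\mu-\mu_p)t-2}+1 & t\in[\tfrac1L,\tau],\\[2mm] \dfrac{(Lt-1)^2}{(Lt-1)^2+(2-Lt)\mu_p t} & t\in(\tau,\tfrac2L).\end{cases}$$ *)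

(* Defs.v *)
From HB Require Import structures.
From mathcomp Require Import all_boot all_order all_algebra.
From mathcomp Require Import all_classical all_reals all_analysis.

Set Implicit Arguments.
Unset Strict Implicit.
Unset Printing Implicit Defensive.

Import Order.TTheory GRing.Theory Num.Theory.
Import numFieldNormedType.Exports.

Local Open Scope classical_set_scope.
Local Open Scope ring_scope.

Section smooth_functions.
Context {R : realType} {n : nat}.
Implicit Types (x v : 'rV[R]_n) (f : 'rV[R]_n -> R^o).

(* The library's norm on ['rV[R]_n] is the sup norm; it is equivalent to this
   one, so [differentiable] has its usual meaning. *)
Definition enorm v : R := Num.sqrt (\sum_(i < n) v 0 i ^+ 2).

Definition gradient f x : 'rV[R]_n := \row_(i < n) 'D_(delta_mx 0 i) f x.

Definition smooth_class (mu L : R) f : Prop :=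
  [/\ forall x, differentiable f x,
      convex_function setT (fun x => L / 2 * enorm x ^+ 2 - f x) &
      convex_function setT (fun x => f x - mu / 2 * enorm x ^+ 2)].

Definition polyak_lojasiewicz (mu_p : R) f (X : set 'rV[R]_n) : Prop :=
  forall x, X x ->
    f x - inf (range f) <= (2 * mu_p)^-1 * enorm (gradient f x) ^+ 2.

End smooth_functions.

Section step_length.
Context {R : realType}.
Variables mu L mu_p : R.

Definition tau : R := 3 / (mu + L + Num.sqrt (mu ^+ 2 - L * mu + L ^+ 2)).

(* Meaningful on the interval (0, 2 / L) only. *)
Definition rate (t : R) : R :=
  if t < L^-1 then
    ((mu_p * (1 - L * t)
      + Num.sqrt ((L - mu) * (mu - mu_p) * (2 - L * t) * mu_p * t
                  + (L - mu) ^+ 2))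
     / (L - mu + mu_p)) ^+ 2
  else if t <= tau then
    (L * t - 2) * (mu * t - 2) * mu_p * t / ((L + mu - mu_p) * t - 2) + 1
  else
    (L * t - 1) ^+ 2 / ((L * t - 1) ^+ 2 + (2 - L * t) * mu_p * t).

Definition cubic (t : R) : R :=
  L * mu * (L + mu - mu_p) * t ^+ 3
  - (L ^+ 2 - mu_p * (L + mu) + 5 * L * mu + mu ^+ 2) * t ^+ 2
  + 4 * (L + mu) * t - 4.

Definition cubic_roots : set R :=
  [set t | L^-1 <= t <= tau /\ cubic t = 0].

(* [xget] returns an element of [cubic_roots] if there is one, and [tau]
   otherwise; that the element is unique is not part of this definition. *)
Definition optimal_step : R := xget tau cubic_roots.

End step_length.

(* Main.v *)
(** The middle branch m of the rate satisfies
    m t - m s = c * (t - s) * G(s, t) with c > 0 and G symmetric,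
    G(t, t) = 2 r(t). If G(s, t) >= 0 then G(s', t) > 0 for every s' > s, so r
    can change sign only once, from negative to positive, and m decreases
    strictly before that point and increases strictly after it; no derivative
    is needed. The first branch is decreasing, the last one is increasing, and
    the branches agree at 1 / L and tau, where 3 - 2 (L + mu) tau + L mu tau^2
    = 0; so the minimum lies in [1 / L, tau]. *)

Require Import Defs.
From HB Require Import structures.
From mathcomp Require Import all_boot all_order all_algebra.
From mathcomp Require Import all_classical all_reals all_analysis.
From mathcomp Require Import ring lra.

Import Order.TTheory GRing.Theory Num.Theory.
Import numFieldNormedType.Exports.

Local Open Scope classical_set_scope.
Local Open Scope ring_scope.

Section rate_minimization.
Context {R : realType} (L mu mu_p : R).
Hypothesis params : [/\ 0 < L, mu <= 0, 0 < mu_p & mu_p <= L].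

(** * The middle branch and its difference quotient *)

Definition mid_rate (t : R) : R :=
  (L * t - 2) * (mu * t - 2) * mu_p * t / ((L + mu - mu_p) * t - 2) + 1.

(* The numerator of (mid_rate t - mid_rate s) / (t - s), up to the factor
   mu_p. *)
Definition secant (s t : R) : R :=
  (2 - mu * s) * (2 - mu * t) * (L * (s + t) - 2)
  - (L - mu_p) * s * t * (2 * L - mu * (L * (s + t) - 2)).

Lemma gt0_of_mulL (t : R) : 1 <= L * t -> 0 < t.
Proof.
have [L_gt0 mu_le0 mu_p_gt0 mu_p_leL] := params.
by rewrite -(pmulr_rgt0 t L_gt0); exact: lt_le_trans.
Qed.

Lemma secantC (s t : R) : secant s t = secant t s.
Proof. by rewrite /secant; ring. Qed.

Lemma secant_diag (t : R) : secant t t = 2 * cubic mu L mu_p t.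
Proof. by rewrite /secant /cubic; ring. Qed.

Lemma mid_den_lt0 (t : R) : 1 <= L * t < 2 -> (L + mu - mu_p) * t - 2 < 0.
Proof.
have [L_gt0 mu_le0 mu_p_gt0 mu_p_leL] := params.
move=> /andP[Lt_ge1 Lt_lt2]; have t_gt0 := gt0_of_mulL _ Lt_ge1.
have -> : (L + mu - mu_p) * t - 2 = (L * t - 2) - (mu_p - mu) * t by ring.
have : 0 < (mu_p - mu) * t by rewrite mulr_gt0//; lra.
by lra.
Qed.

Lemma mid_rateB (s t : R) : 1 <= L * s < 2 -> 1 <= L * t < 2 ->
  mid_rate t - mid_rate s =
  (t - s) * secant s t
  * (mu_p / (((L + mu - mu_p) * s - 2) * ((L + mu - mu_p) * t - 2))).
Proof.
move=> /mid_den_lt0/ltr0_neq0 s0 /mid_den_lt0/ltr0_neq0 t0.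
by rewrite /mid_rate /secant; field; rewrite s0 t0.
Qed.

(** The last factor in [mid_rateB] is positive, being [mu_p] over a product of two negative
    denominators. *)
Lemma mid_rate_le (s t : R) : 1 <= L * s < 2 -> 1 <= L * t < 2 ->
  0 <= (t - s) * secant s t -> mid_rate s <= mid_rate t.
Proof.
have [L_gt0 mu_le0 mu_p_gt0 mu_p_leL] := params.
move=> hs ht h; rewrite -subr_ge0 mid_rateB// mulr_ge0//.
by rewrite divr_ge0 ?(ltW mu_p_gt0)// ltW// nmulr_rgt0 mid_den_lt0.
Qed.

Lemma secant_gt0 (s s' t : R) : 1 <= L * s -> s < s' -> 1 <= L * t < 2 ->
  0 <= secant s t -> 0 < secant s' t.
Proof.
have [L_gt0 mu_le0 mu_p_gt0 mu_p_leL] := params.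
move=> hs ss' /andP[ht1 ht2] h.
have t_gt0 := gt0_of_mulL _ ht1.
(* The sign of secant z t is the one of x z / y z - c for some c >= 0, with
   x z = y z - 2 * (2 - L * t) and y increasing. *)
pose y z := z * (2 * L - mu * (L * (z + t) - 2)).
have y_gt0 z : 1 <= L * z -> 0 < y z.
  move=> hz; have z_gt0 := gt0_of_mulL _ hz.
  rewrite mulr_gt0//.
  have : 0 <= - mu * (L * (z + t) - 2) by rewrite mulr_ge0; lra.
  by lra.
have hs' : 1 <= L * s' by nra.
have yss' : y s < y s'.
  (* This is the part of [y s' - y s] beyond [2 * L * (s' - s)]. *)
  have : 0 <= - mu * ((s' - s) * (L * (s + s' + t) - 2)).
    by rewrite mulr_ge0 ?oppr_ge0// mulr_ge0; lra.
  by rewrite /y; nra.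
(* Cross-multiplication cancels the multiples of [y]; only the constant [2 * (2 - L * t)] by which
   [x] and [y] differ survives. *)
have E : secant s' t * y s = secant s t * y s'
    + (2 - mu * t) * (2 * (2 - L * t)) * (y s' - y s).
  by rewrite /secant /y; ring.
have e_gt0 : 0 < 2 - mu * t by nra.
rewrite -(pmulr_lgt0 _ (y_gt0 _ hs)) E ltr_wpDl//.
  by rewrite mulr_ge0 // ltW// y_gt0.
by rewrite !mulr_gt0//; lra.
Qed.

(** * The break points 1 / L and tau *)

Lemma invL_le (t : R) : (L^-1 <= t) = (1 <= L * t).
Proof.
have [L_gt0 mu_le0 mu_p_gt0 mu_p_leL] := params.
by rewrite -ler_pdivrMl// mulr1.
Qed.

(** The radicand is (L/2 - mu)^2 + 3 L^2 / 4 and is at most (2 L - mu)^2, so its root [S] satisfies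
    L/2 - mu < S <= 2 L - mu. *)
Lemma tau_bounds : 1 <= L * tau mu L < 2.
Proof.
have [L_gt0 mu_le0 mu_p_gt0 mu_p_leL] := params.
rewrite /tau; set S := Num.sqrt _.
have S0 : 0 <= S by exact: sqrtr_ge0.
have S2 : S ^+ 2 = mu ^+ 2 - L * mu + L ^+ 2 by rewrite sqr_sqrtr//; nra.
have lo : 3 * L / 2 < mu + L + S by nra.
have hi : mu + L + S <= 3 * L by nra.
have pos : 0 < mu + L + S by lra.
by rewrite mulrA ler_pdivlMr// ltr_pdivrMr//; apply/andP; split; lra.
Qed.

(** For mu < 0, [tau] is the root (L + mu - S) / (L mu) of this quadratic, rationalized into a form
    that also covers mu = 0. *)
Lemma tau_root : 3 - 2 * (L + mu) * tau mu L + L * mu * tau mu L ^+ 2 = 0.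
Proof.
have [L_gt0 mu_le0 mu_p_gt0 mu_p_leL] := params.
have /andP[h _] := tau_bounds; move: h.
rewrite /tau; set S := Num.sqrt _ => h.
have S2 : S ^+ 2 = mu ^+ 2 - L * mu + L ^+ 2 by rewrite sqr_sqrtr//; nra.
have nz : mu + L + S != 0.
  (* The inverse of 0 is 0, so a zero denominator would give [L * tau = 0], against the lower bound
     1. *)
  by apply: contraTneq h => ->; rewrite invr0 !mulr0 ler10.
have -> : 3 - 2 * (L + mu) * (3 / (mu + L + S))
    + L * mu * (3 / (mu + L + S)) ^+ 2
    = 3 * (S ^+ 2 - (mu ^+ 2 - L * mu + L ^+ 2)) / (mu + L + S) ^+ 2.
  by field.
by rewrite S2 subrr mulr0 mul0r.
Qed.

(** * Comparison with the outer branches *)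

Lemma rate_mid (t : R) : 1 <= L * t -> t <= tau mu L ->
  rate mu L mu_p t = mid_rate t.
Proof.
by move=> h1 h2; rewrite /rate ltNge invL_le h1 /= h2.
Qed.

Lemma mid_rate_le_short (t : R) : 0 < t -> L * t < 1 ->
  mid_rate L^-1 <= rate mu L mu_p t.
Proof.
have [L_gt0 mu_le0 mu_p_gt0 mu_p_leL] := params.
move=> t_gt0 Lt1; rewrite /rate ltNge invL_le -ltNge Lt1.
have den_gt0 : 0 < L - mu + mu_p by lra.
set q := _ + (L - mu) ^+ 2.
(* [v] is the value of [q] at t = 1 / L; since (2 - L t) t = (1 - (1 - L t)^2) / L, [q] exceeds it
   by a multiple of a square. *)
set v := (L - mu) * (L - mu_p) * (L - mu + mu_p) / L.
have -> : mid_rate L^-1 = v / (L - mu + mu_p) ^+ 2.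
  rewrite /mid_rate /v; field.
  by rewrite (gt_eqF den_gt0) (gt_eqF L_gt0) lt_eqF//; lra.
have v_ge0 : 0 <= v.
  by rewrite divr_ge0 ?(ltW L_gt0)// !mulr_ge0//; lra.
have vq : v <= q.
  have -> : q = v + (L - mu) * (mu_p - mu) * mu_p * (1 - L * t) ^+ 2 / L.
    by rewrite /q /v; field; rewrite gt_eqF.
  rewrite lerDl divr_ge0 ?(ltW L_gt0)// !mulr_ge0 ?sqr_ge0//; lra.
have q_ge0 : 0 <= q by exact: le_trans vq.
rewrite expr_div_n ler_pM2r ?invr_gt0 ?exprn_gt0//.
apply: (le_trans vq); rewrite -{1}(sqr_sqrtr q_ge0).
have S0 := sqrtr_ge0 q.
have w_ge0 : 0 <= mu_p * (1 - L * t) by rewrite mulr_ge0; lra.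
by rewrite lerXn2r ?nnegrE ?addr_ge0// lerDr.
Qed.

(** The difference of the two branches contains the quadratic of [tau_root] as a factor. *)
Lemma mid_rate_tau : mid_rate (tau mu L) =
  (L * tau mu L - 1) ^+ 2
  / ((L * tau mu L - 1) ^+ 2 + (2 - L * tau mu L) * mu_p * tau mu L).
Proof.
have [L_gt0 mu_le0 mu_p_gt0 mu_p_leL] := params.
move: (tau mu L) tau_bounds tau_root => t ht root.
have d0 := mid_den_lt0 _ ht; case/andP: ht => h1 h2.
have t_gt0 := gt0_of_mulL _ h1.
have D_gt0 : 0 < (L * t - 1) ^+ 2 + (2 - L * t) * mu_p * t.
  have : 0 < (2 - L * t) * mu_p * t by rewrite !mulr_gt0//; lra.
  have := sqr_ge0 (L * t - 1); lra.
apply/eqP; rewrite -subr_eq0.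
have -> : mid_rate t -
  (L * t - 1) ^+ 2 / ((L * t - 1) ^+ 2 + (2 - L * t) * mu_p * t)
  = (2 - L * t) * mu_p * (mu_p - L) * t ^+ 2
    * (3 - 2 * (L + mu) * t + L * mu * t ^+ 2)
    / (((L + mu - mu_p) * t - 2) * ((L * t - 1) ^+ 2 + (2 - L * t) * mu_p * t)).
  by rewrite /mid_rate; field; rewrite gt_eqF// lt_eqF.
by rewrite root mulr0 mul0r.
Qed.

Lemma mid_rate_le_long (t : R) : tau mu L < t -> L * t < 2 ->
  mid_rate (tau mu L) <= rate mu L mu_p t.
Proof.
have [L_gt0 mu_le0 mu_p_gt0 mu_p_leL] := params.
move=> tau_t Lt2; have /andP[h1 h2] := tau_bounds.
have tau_gt0 := gt0_of_mulL _ h1.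
have Lt1 : 1 <= L * t by nra.
rewrite mid_rate_tau /rate ltNge invL_le Lt1 /= (leNgt t) tau_t /=.
have D_gt0 z : 0 < z -> L * z < 2 ->
    0 < (L * z - 1) ^+ 2 + (2 - L * z) * mu_p * z.
  move=> z0 z2; have : 0 < (2 - L * z) * mu_p * z by rewrite !mulr_gt0//; lra.
  have := sqr_ge0 (L * z - 1); lra.
have Dt := D_gt0 t (lt_trans tau_gt0 tau_t) Lt2.
have Dtau := D_gt0 _ tau_gt0 h2.
rewrite ler_pdivrMr// mulrAC ler_pdivlMr// -subr_ge0.
move: (tau mu L) tau_t h1 h2 tau_gt0 {Dtau} => s tau_t h1 h2 tau_gt0.
(* As (2 - L z) z = (1 - (L z - 1)^2) / L, the products of squares cancel and a difference of
   squares remains. *)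
have -> : (L * t - 1) ^+ 2 * ((L * s - 1) ^+ 2 + (2 - L * s) * mu_p * s)
  - (L * s - 1) ^+ 2 * ((L * t - 1) ^+ 2 + (2 - L * t) * mu_p * t)
  = mu_p * (t - s) * (L * (s + t) - 2) by ring.
by rewrite !mulr_ge0//; lra.
Qed.

(** * Sign of the cubic and minimization of the middle branch *)

Lemma secant_gt0_of_cubic (s t : R) : 1 <= L * s -> L * t < 2 -> s < t ->
  0 <= cubic mu L mu_p s -> 0 < secant s t.
Proof.
have [L_gt0 mu_le0 mu_p_gt0 mu_p_leL] := params.
(* Start on the diagonal, where the secant is twice the cubic at [s], and move one argument up to
   [t]. *)
move=> s1 t2 st h; rewrite secantC; apply: (@secant_gt0 s) => //.
  by rewrite s1 (lt_trans _ t2)// ltr_pM2l.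
by rewrite secant_diag mulr_ge0.
Qed.

Lemma secant_lt0_of_cubic (s t : R) : 1 <= L * s -> L * t < 2 -> s < t ->
  cubic mu L mu_p t <= 0 -> secant s t < 0.
Proof.
have [L_gt0 mu_le0 mu_p_gt0 mu_p_leL] := params.
(* A nonnegative secant would turn positive on the diagonal once [s] moves up to [t]. *)
move=> s1 t2 st h; rewrite ltNge; apply/negP => sec.
have t1 : 1 <= L * t by rewrite (le_trans s1)// ler_pM2l// ltW.
have := @secant_gt0 s t t s1 st; rewrite t1 t2 secant_diag => /(_ isT sec).
by lra.
Qed.

Lemma cubic_root_uniq (s t : R) :
  cubic_roots mu L mu_p s -> cubic_roots mu L mu_p t -> s = t.
Proof.
have [L_gt0 mu_le0 mu_p_gt0 mu_p_leL] := params.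
have /andP[_ tau2] := tau_bounds.
wlog st : s t / s < t.
  move=> H hs ht; case: (ltgtP s t) => // [st|ts]; first exact: H.
  by symmetry; exact: H.
move=> [/andP[]]; rewrite invL_le => s1 _ rs [/andP[_ t_tau] rt].
have t2 : L * t < 2 by apply: le_lt_trans tau2; rewrite ler_pM2l.
have := secant_lt0_of_cubic _ _ s1 t2 st.
have := secant_gt0_of_cubic _ _ s1 t2 st.
by rewrite rs rt lexx => /(_ isT) h1 /(_ isT); rewrite ltNge ltW.
Qed.

(** The cubic equals (mu_p - L) / L <= 0 at 1 / L, so a nonnegative value at tau would force a root
    in between. *)
Lemma cubic_tau_lt0 : (forall t, ~ cubic_roots mu L mu_p t) ->
  cubic mu L mu_p (tau mu L) < 0.
Proof.
have [L_gt0 mu_le0 mu_p_gt0 mu_p_leL] := params.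
move=> noroot; rewrite ltNge; apply/negP => tau_ge0.
pose P : {poly R} := (L * mu * (L + mu - mu_p)) *: 'X^3
  - (L ^+ 2 - mu_p * (L + mu) + 5 * L * mu + mu ^+ 2) *: 'X^2
  + (4 * (L + mu)) *: 'X - 4%:P.
have PE t : P.[t] = cubic mu L mu_p t by rewrite /P /cubic !hornerE.
have invL_tau : L^-1 <= tau mu L.
  by rewrite invL_le; case/andP: tau_bounds.
have lo : cubic mu L mu_p L^-1 <= 0.
  have -> : cubic mu L mu_p L^-1 = (mu_p - L) / L.
    by rewrite /cubic; field; rewrite gt_eqF.
  by rewrite pmulr_lle0 ?invr_gt0// subr_le0.
have [|t ht /eqP rt] := @poly_ivt R P _ _ invL_tau.
  by rewrite !PE lo tau_ge0.
by apply: (noroot t); split=> //; rewrite -PE.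
Qed.

(** Merges the two cases: the sign of the cubic at [s] handles points left of [s]; to the right,
    either the cubic vanishes at [s] or no point up to tau is left. *)
Lemma optimal_stepP (s := optimal_step mu L mu_p) :
  [/\ 1 <= L * s, s <= tau mu L, cubic mu L mu_p s <= 0
    & s = tau mu L \/ cubic mu L mu_p s = 0].
Proof.
rewrite {}/s; have /andP[tau1 _] := tau_bounds.
have [[t rt]|noroot] := pselect (exists t, cubic_roots mu L mu_p t).
  have [] : cubic_roots mu L mu_p (optimal_step mu L mu_p).
    by apply: xgetPex; exists t.
  by rewrite invL_le => /andP[s1 s2] ->; split=> //; right.
have {}noroot t : ~ cubic_roots mu L mu_p t.
  by move=> rt; apply: noroot; exists t.
rewrite /optimal_step xgetPN//; split=> //; last by left.
by rewrite ltW// cubic_tau_lt0.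
Qed.

Lemma mid_rate_min (t : R) : 1 <= L * t -> t <= tau mu L ->
  mid_rate (optimal_step mu L mu_p) <= mid_rate t.
Proof.
have [L_gt0 mu_le0 mu_p_gt0 mu_p_leL] := params.
have /andP[_ tau2] := tau_bounds.
have le_tau z : z <= tau mu L -> L * z < 2.
  by move=> hz; apply: le_lt_trans tau2; rewrite ler_pM2l.
have [] := optimal_stepP.
move: (optimal_step _ _ _) => s s1 s2 rs s_cases t1 t2.
apply: mid_rate_le; rewrite ?s1 ?t1 ?le_tau//.
case: (ltgtP t s) => [ts|st|->]; last by rewrite subrr mul0r.
  rewrite secantC nmulr_rge0 ?subr_lt0// ltW//.
  by rewrite secant_lt0_of_cubic// le_tau.
apply: mulr_ge0; first by rewrite subr_ge0 ltW.
rewrite ltW// secant_gt0_of_cubic// ?le_tau//.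
by case: s_cases => [s_tau|->//]; move: st; rewrite s_tau ltNge t2.
Qed.

End rate_minimization.

Theorem proposition1 (R : realType) (n : nat) (L mu mu_p : R)
    (f : 'rV[R]_n -> R^o) (x1 : 'rV[R]_n)
    (L_gt0 : 0 < L) (mu_le0 : mu <= 0)
    (f_smooth : smooth_class mu L f)
    (fstar_finite : has_inf (range f))
    (mu_p_gt0 : 0 < mu_p) (mu_p_leL : mu_p <= L)
    (f_PL : polyak_lojasiewicz mu_p f [set x | f x <= f x1]) :
  (forall s t, cubic_roots mu L mu_p s -> cubic_roots mu L mu_p t -> s = t) /\
  let tstar := optimal_step mu L mu_p in
  0 < tstar < 2 / L /\
  forall t : R, 0 < t < 2 / L -> rate mu L mu_p tstar <= rate mu L mu_p t.
Proof.
have params : [/\ 0 < L, mu <= 0, 0 < mu_p & mu_p <= L] by [].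
have /andP[tau1 tau2] := tau_bounds _ _ _ params.
have [s1 s_tau _ _] := optimal_stepP _ _ _ params.
split; first exact: cubic_root_uniq params.
split=> [|t].
  rewrite (gt0_of_mulL _ _ _ params _ s1) /= ltr_pdivlMr// mulrC.
  by rewrite (le_lt_trans _ tau2)// ler_pM2l.
rewrite ltr_pdivlMr// mulrC => /andP[t_gt0 t2].
rewrite (rate_mid _ _ _ params)//.
(* Outside the middle range, the values at 1 / L and tau serve as intermediate bounds. *)
have [t1|t1] := ltP (L * t) 1.
  apply: le_trans (mid_rate_le_short _ _ _ params _ t_gt0 t1).
  apply: (mid_rate_min _ _ _ params); rewrite ?(invL_le _ _ _ params)//.
  by rewrite divff// gt_eqF.
have [t_tau|t_tau] := leP t (tau mu L).
  by rewrite (rate_mid _ _ _ params)// (mid_rate_min _ _ _ params).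
apply: le_trans (mid_rate_le_long _ _ _ params _ t_tau t2).
exact: (mid_rate_min _ _ _ params).
Qed.
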